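(* Let $q$ be a fixed complex number with $0<|q|<1$, and let $x,y,z,w\in\mathbb{C}$ satisfy $|xy|<1$, $|y|<1$, and $z\neq q^{-r}$, $w\ne q^{-r}$ for all $r\in\mathbb{N}$. Then $$A(x,y,z,w)=wA(xq,y,z,w)+L(z,y,xy)\qquad\text{(if moreover } |z|<1),$$ $$A(x,y,z,w)=zA(x,yq,z,w)+\frac{1}{1-y}L(xy,w),$$ $$A(x,y,z,w)=yA(x,y,zq,w)+L(xy,z,w),$$ $$A(x,y,z,w)=xA(x,y,z,wq)+\frac{1}{1-w}L(y,z)-xL(xy,z,wq).$$
   Context: $\mathbb{N}=\{0,1,2,\dots\}$, and $q$ is complex with $0<|q|<1$. The double Lambert series is $$A(x,y,z,w)=A(x,y,z,w;q):=\sum_{n=0}^\infty\sum_{m\ge n}\frac{x^n y^m}{(1-wq^n)(1-zq^m)},$$ defined for $|xy|<1$, $|y|<1$, $z\ne q^{-r}$, $w\neq q^{-r}$ ($r\in\mathbb{N}$). The Lambert series is $$L(x,y_1,\dots,y_k)=L(x,y_1,\dots,y_k;q):=\sum_{n=0}^\infty\frac{x^n}{(1-y_1q^n)\cdots(1-y_kq^n)},$$ defined for $|x|<1$ and $y_i\ne q^{-r}$ ($r\in\mathbb{N}$). Here $0^0=1$. *)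

(* Defs.v *)
From HB Require Import structures.
From mathcomp Require Import all_boot all_order all_algebra.
From mathcomp Require Import complex.
From mathcomp Require Import all_classical all_reals all_analysis.

Set Implicit Arguments.
Unset Strict Implicit.
Unset Printing Implicit Defensive.

Import Order.TTheory GRing.Theory Num.Theory.
Import numFieldNormedType.Exports.
Local Open Scope ring_scope.
Local Open Scope complex_scope.

(* The limits below are taken in [R[i]^o] because the topology induced by the
   modulus is registered on this alias, and not on [R[i]] itself. *)

Definition double_lambert (R : realType) (q x y z w : R[i]) : R[i] :=
  \big[+%R/0]_(0 <= n <oo) \big[+%R/0]_(n <= m <oo)
    (x ^+ n * y ^+ m / ((1 - w * q ^+ n) * (1 - z * q ^+ m)) : R[i]^o).

(* [ys] is the list of the parameters y_1, ..., y_k. *)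
Definition lambert (R : realType) (q x : R[i]) (ys : seq R[i]) : R[i] :=
  \big[+%R/0]_(0 <= n <oo)
    (x ^+ n / \prod_(y <- ys) (1 - y * q ^+ n) : R[i]^o).

(* Main.v *)
Require Import Defs.
From mathcomp Require Import all_boot all_order all_algebra.
From mathcomp Require Import complex ring.
From mathcomp Require Import all_classical all_reals all_analysis.

(** Write T_n for the tail of the inner series y^m / (1 - z q^m), m >= n, so that
A(x,y,z,w) is the sum of x^n T_n / (1 - w q^n). Every identity comes from a
relation between tails, and is proved without rearranging a double series. Below
a prime marks the tails for the modified parameter.

- Replacing y by y q: T_n - z T'_n is the tail of the geometric series in y,
  because the factor 1 - z q^m cancels.
- Replacing z by z q: T_n - y T'_n is the single term y^n / (1 - z q^n), because
  the new inner series is, up to the factor y, the old one shifted by one.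
- Replacing w by w q: the same shift is applied to the outer series, and T_(n+1)
  is rewritten as T_n - y^n / (1 - z q^n).
- Replacing x by x q: A(x,y,z,w) - w A(xq,y,z,w) is the sum of x^n T_n. Expanding
  1 / (1 - z q^m) in powers of z, then summing over m and over n, gives
  L(z,y,xy).

The tool is the predicate [remainders]: a sequence T consists of the tails of the
series a exactly when T_n = a_n + T_(n+1) and T tends to 0. Such a T is
unique ([remainders_unique]), so that a claim about the sum of a series becomes an
algebraic recurrence together with a limit. Even the two exchanges of summation in
the last identity take this form ([power_interchange]): the exchanged series
satisfies the recurrence termwise, and tends to 0 by a uniform geometric bound. *)

Import Order.TTheory GRing.Theory Num.Theory.
Import numFieldNormedType.Exports.
Local Open Scope ring_scope.
Local Open Scope complex_scope.
Local Open Scope classical_set_scope.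

(** * Convergence of complex sequences and series *)

(** The topology of the modulus is the one carried by the alias [R[i]^o]. *)
Definition cvgc {R : realType} (u : nat -> R[i]) (l : R[i]) : Prop :=
  (u n : R[i]^o) @[n --> \oo] --> (l : R[i]^o).

Lemma cvgc_cst {R : realType} (a : R[i]) : cvgc (fun=> a) a.
Proof. exact: (@cvg_cst R[i]^o). Qed.

Lemma cvgcB {R : realType} {u v : nat -> R[i]} {a b : R[i]} :
  cvgc u a -> cvgc v b -> cvgc (fun n => u n - v n) (a - b).
Proof. by move=> ua vb; exact: (@cvgB _ R[i]^o _ _ _ _ _ _ _ ua vb). Qed.

Lemma cvgcZ {R : realType} (c : R[i]) {u : nat -> R[i]} {a : R[i]} :
  cvgc u a -> cvgc (fun n => c * u n) (c * a).
Proof. by move=> ua; exact: (@cvgMl_tmp R[i] _ _ _ _ c _ ua). Qed.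

(** A positive [e] of [R[i]] is a real number, so this form transfers to complex
sequences the limits known for their moduli. *)
Lemma cvgc0P {R : realType} {u : nat -> R[i]} :
  cvgc u 0 <-> forall e, 0 < e -> exists N, forall n, (N <= n)%N -> `|u n| < e.
Proof.
split=> [/cvgr0Pnorm_lt u0 e /u0[N _ uN]|u0]; first by exists N => n /uN.
by apply/cvgr0Pnorm_lt => e /u0[N uN]; exists N => // n /= /uN.
Qed.

Lemma cvgc_real {R : realType} {u : nat -> R} {l : R} :
  u n @[n --> \oo] --> l -> cvgc (fun n => (u n)%:C) l%:C.
Proof.
move=> /cvgrPdist_lt ul; apply/cvgrPdist_lt => e e0.
have eE : e = (complex.Re e)%:C by rewrite RRe_real // gtr0_real.
have {}e0 : 0 < complex.Re e by rewrite -ltcR -eE.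
near=> n.
have : `|l - u n| < complex.Re e by near: n; exact: ul.
by rewrite -rmorphB eE normc_def /= expr0n addr0 sqrtr_sqr ltcR.
Unshelve. all: by end_near. Qed.

Lemma normc_real {R : realType} (z : R[i]) : exists2 r : R, 0 <= r & `|z| = r%:C.
Proof.
exists (complex.Re `|z|); last by rewrite RRe_real // normr_real.
by rewrite -ler0c RRe_real // normr_real.
Qed.

Lemma expr_cvg0 {R : realType} {r : R[i]} :
  `|r| < 1 -> cvgc (fun n => r ^+ n) 0.
Proof.
have [s s0 sE] := normc_real r.
rewrite sE -(rmorph1 (real_complex R)) ltcR => s1.
have /cvg_expr/cvgc_real/cvgc0P scvg : `|s| < 1 by rewrite ger0_norm.
apply/cvgc0P => e /scvg[N sN]; exists N => n /sN.
by rewrite normrX sE -rmorphXn ger0_norm // ler0c exprn_ge0.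
Qed.

(** The modulus is taken inside, so that the parameters of a series serve directly
as ratios; the case [r = 1] says that the sequence is bounded by [C]. *)
Definition dominated {R : realType} (C r : R[i]) (a : nat -> R[i]) :=
  forall n, `|a n| <= C * `|r| ^+ n.

Lemma dominated_cvg0 {R : realType} {C r : R[i]} {a : nat -> R[i]} :
  `|r| < 1 -> dominated C r a -> cvgc a 0.
Proof.
move=> r1 aC; apply/cvgc0P => e e0.
have : cvgc (fun n => C * `|r| ^+ n) 0.
  by rewrite -(mulr0 C); apply/cvgcZ/expr_cvg0; rewrite normr_id.
move=> /cvgc0P/(_ e e0)[N rN]; exists N => n /rN; apply: le_lt_trans.
by rewrite [leRHS]ger0_norm ?aC // (le_trans _ (aC n)).
Qed.

Lemma dominated_expr {R : realType} (r : R[i]) : dominated 1 r (fun n => r ^+ n).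
Proof. by move=> n; rewrite normrX mul1r. Qed.

Lemma dominatedM {R : realType} {C D r s : R[i]} {a b : nat -> R[i]} :
  dominated C r a -> dominated D s b ->
  dominated (C * D) (r * s) (fun n => a n * b n).
Proof.
move=> aC bD n; rewrite !normrM exprMn mulrACA.
by rewrite ler_pM // ?normr_ge0 ?aC ?bD.
Qed.

(** Real and imaginary parts converge absolutely by comparison with a real
geometric series. *)
Lemma dominated_series_cvg {R : realType} {C r : R[i]} {a : nat -> R[i]} :
  `|r| < 1 -> dominated C r a ->
  exists S, cvgc (fun n => \sum_(0 <= k < n) a k) S.
Proof.
move=> r1 aC; have [rho rho0 rhoE] := normc_real r.
have [c cE] : exists c : R, C = c%:C.
  exists (complex.Re C); rewrite RRe_real // ger0_real //.
  by have := aC 0%N; rewrite expr0 mulr1; exact: le_trans.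
have cvgRe (b : nat -> R[i]) : dominated C r b ->
    cvgn (series (fun n => complex.Re (b n))).
  move=> bC; have {}bC n : `|complex.Re (b n)| <= geometric c rho n.
    rewrite -lecR (le_trans (normc_ge_Re _)) // (le_trans (bC n)) //.
    by rewrite rhoE cE rmorphM rmorphXn.
  apply: normed_cvg; apply: (@series_le_cvg _ _ (geometric c rho)).
  - by move=> n; exact: normr_ge0.
  - by move=> n; exact: le_trans (bC n).
  - exact: bC.
  by apply: is_cvg_geometric_series; rewrite ger0_norm // -ltcR -rhoE.
have cRe := cvgc_real (cvgRe _ aC).
(* the imaginary part of z is minus the real part of i z *)
have /cvgRe cIm : dominated C r (fun n => a n * 'i%C).
  by move=> n; rewrite normrM complexiE normCi mulr1.
have := cvgcB cRe (cvgcZ 'i%C (cvgc_real cIm)); set S := (X in cvgc _ X).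
move=> aS; exists S; move: aS; congr (cvgc _ S); apply/funext => n.
rewrite /series /= !rmorph_sum /= mulr_sumr -sumrB.
by apply: eq_bigr => k _; rewrite ReiNIm rmorphN mulrN opprK -complexE.
Qed.

(** * Tails of convergent series *)

Lemma eq_series {R : realType} {n : nat} {a b : nat -> R[i]} : a =1 b ->
  \big[+%R/0]_(n <= m <oo) (a m : R[i]^o)
    = \big[+%R/0]_(n <= m <oo) (b m : R[i]^o).
Proof. by move=> /funext->. Qed.

(** The sequence of tails of the series [a], characterised by its recurrence
rather than as a limit, so that linear combinations, shifts and term-by-term
identities of series become algebra. *)
Definition remainders {R : realType} (a T : nat -> R[i]) : Prop :=
  (forall n, T n = a n + T n.+1) /\ cvgc T 0.

(** By telescoping, the partial sum from [n] to [N] is [T n - T N]. *)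
Lemma remainders_sum {R : realType} {a T : nat -> R[i]} (n : nat) :
  remainders a T -> \big[+%R/0]_(n <= m <oo) (a m : R[i]^o) = T n.
Proof.
move=> [Ta T0]; apply: cvg_lim; first exact: norm_hausdorff.
have : cvgc (fun N => T n - T N) (T n).
  by rewrite -[X in cvgc _ X]subr0; exact: (cvgcB (cvgc_cst _) T0).
apply: cvg_trans; apply: near_eq_cvg; near=> N.
have nN : (n <= N)%N by near: N; exists n.
rewrite -(opprB (T N)) -telescope_sumr // -sumrN.
by apply: eq_bigr => k _; rewrite [T k]Ta opprB addrK.
Unshelve. all: by end_near. Qed.

Lemma remainders_unique {R : realType} {a T U : nat -> R[i]} :
  remainders a T -> remainders a U -> T =1 U.
Proof. by move=> aT aU n; rewrite -(remainders_sum n aT) (remainders_sum n aU). Qed.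

Lemma remainders_ext {R : realType} {a b T : nat -> R[i]} :
  a =1 b -> remainders a T -> remainders b T.
Proof. by move=> /funext->. Qed.

Lemma remaindersZ {R : realType} (c : R[i]) {a T : nat -> R[i]} :
  remainders a T -> remainders (fun n => c * a n) (fun n => c * T n).
Proof.
move=> [Ta T0]; split=> [n|]; first by rewrite Ta mulrDr.
by rewrite -(mulr0 c); exact: cvgcZ.
Qed.

Lemma remaindersB {R : realType} {a b T U : nat -> R[i]} :
  remainders a T -> remainders b U ->
  remainders (fun n => a n - b n) (fun n => T n - U n).
Proof.
move=> [Ta T0] [Ub U0]; split=> [n|]; first by rewrite Ta Ub opprD addrACA.
by rewrite -(subr0 0); exact: cvgcB.
Qed.

Lemma remainders_shift {R : realType} {a T : nat -> R[i]} :
  remainders a T -> remainders (fun n => a n.+1) (fun n => T n.+1).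
Proof.
move=> [Ta /cvgc0P T0]; split=> //; apply/cvgc0P => e /T0[N TN].
by exists N => n Nn; rewrite TN // leqW.
Qed.

Lemma geometric_remainders {R : realType} {r : R[i]} : `|r| < 1 ->
  remainders (fun n => r ^+ n) (fun n => (1 - r)^-1 * r ^+ n).
Proof.
move=> r1; have r_neq1 : 1 - r != 0.
  by rewrite subr_eq0; apply: contraTneq r1 => <-; rewrite normr1 ltxx.
split=> [n|]; first by rewrite exprS; field.
by rewrite -(mulr0 (1 - r)^-1); exact/cvgcZ/expr_cvg0.
Qed.

(** The explicit constant lets the tail of one series be used as the general term
of another, with a bound that is uniform in a parameter. *)
Lemma dominated_remainders {R : realType} {C r : R[i]} {a : nat -> R[i]} :
  `|r| < 1 -> dominated C r a ->
  exists2 T, remainders a T & dominated (C / (1 - `|r|)) r T.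
Proof.
move=> r1 aC; have [S aS] := dominated_series_cvg r1 aC.
pose T n := S - \sum_(0 <= k < n) a k.
have Ta n : T n = a n + T n.+1 by rewrite /T big_nat_recr //=; ring.
have T0 : cvgc T 0.
  by rewrite -(subrr S); exact: (cvgcB (cvgc_cst S) aS).
exists T => // n; set B := C / _.
have CE : C = B - B * `|r| by rewrite /B; field; rewrite subr_eq0 gt_eqF.
(* B r^k is the tail of the majorant C r^k, whence this telescoping bound *)
have TB j : `|T n| <= B * `|r| ^+ n - B * `|r| ^+ (n + j) + `|T (n + j)%N|.
  elim: j => [|j]; first by rewrite addn0 subrr add0r.
  move/le_trans; apply; rewrite {1}Ta addnS.
  apply: (@le_trans _ _ (B * `|r| ^+ n - B * `|r| ^+ (n + j)
     + (C * `|r| ^+ (n + j) + `|T (n + j).+1|))).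
    by rewrite lerD2l (le_trans (ler_normD _ _)) // lerD2r aC.
  by rewrite CE exprS le_eqVlt; apply/orP; left; apply/eqP; ring.
have B0 : 0 <= B.
  rewrite divr_ge0 ?subr_ge0 ?(ltW r1) //.
  by have := aC 0%N; rewrite expr0 mulr1; exact: le_trans.
apply/ler_addgt0Pr => e e0; have /cvgc0P/(_ e e0)[N TN] := T0.
apply: (le_trans (TB N)); apply: lerD; last by rewrite ltW // TN // leq_addl.
by rewrite gerBl mulr_ge0 // exprn_ge0.
Qed.

Lemma series_scale {R : realType} {C r : R[i]} {a : nat -> R[i]} (c : R[i]) :
  `|r| < 1 -> dominated C r a ->
  \big[+%R/0]_(0 <= k <oo) (c * a k : R[i]^o)
    = c * \big[+%R/0]_(0 <= k <oo) (a k : R[i]^o).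
Proof.
move=> r1 aC; have [T aT _] := dominated_remainders r1 aC.
by rewrite (remainders_sum 0 (remaindersZ c aT)) (remainders_sum 0 aT).
Qed.

(** * The factors 1 - z q^n *)

Lemma factor_neq0 {R : realType} {q z : R[i]} : 0 < `|q| ->
  (forall r : nat, z <> q ^- r) -> forall n, 1 - z * q ^+ n != 0.
Proof.
move=> q0 hz n; apply/eqP => /subr0_eq zq; apply: (hz n).
have qn0 : q ^+ n != 0 by rewrite expf_neq0 // -normr_gt0.
by rewrite -[LHS](mulfK qn0) -zq mul1r.
Qed.

(** The factors tend to 1, so that their inverses form a convergent, hence
bounded, sequence. *)
Lemma factor_dominated {R : realType} {q : R[i]} (z : R[i]) : `|q| < 1 ->
  exists K, dominated K 1 (fun n => (1 - z * q ^+ n)^-1).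
Proof.
move=> q1; have : cvgc (fun n => (1 - z * q ^+ n)^-1) 1^-1.
  apply: (@cvgV R[i]); first exact: oner_neq0.
  rewrite -[X in _ --> X]subr0 -(mulr0 z).
  exact: (cvgcB (cvgc_cst 1) (cvgcZ z (expr_cvg0 q1))).
move=> zcvg.
have /cvg_seq_bounded :
    cvgn ((fun n => (1 - z * q ^+ n)^-1) : nat -> R[i]^o).
  by apply/cvg_ex; eexists; exact: zcvg.
move=> [M [_ /(_ (M + 1))]] zM; exists (M + 1) => n.
by rewrite normr1 expr1n mulr1; apply: zM; rewrite ?ltrDl ?ltr01.
Qed.

(** The excluded values [q ^- r] lie outside the open unit disc. *)
Lemma small_notin_poles {R : realType} {q p : R[i]} : 0 < `|q| < 1 ->
  `|p| < 1 -> forall r : nat, p <> q ^- r.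
Proof.
move=> /andP[q0 q1] p1 r pq; move: p1; rewrite pq normfV normrX => /lt_geF.
by rewrite invf_ge1 ?exprn_gt0 // exprn_ile1 // ltW.
Qed.

(** * Exchange of summations *)

Lemma dominated_power {R : realType} {q p z C : R[i]} {c : nat -> R[i]} (n : nat) :
  `|q| < 1 -> dominated C z c ->
  dominated (C * `|p| ^+ n) z (fun k => c k * (p * q ^+ k) ^+ n).
Proof.
move=> q1 cC k; rewrite normrM [leRHS]mulrAC ler_pM //.
rewrite normrX normrM normrX exprMn -[leRHS]mulr1 ler_wpM2l ?exprn_ge0 //.
by rewrite !exprn_ile1 ?exprn_ge0 // ltW.
Qed.

(** Summing the powers [(p q^k)^m] over [m >= n] under the sum over [k]. This is
read off from the recurrence: for each [k] the terms on the right for [n] and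
[n.+1] differ by [c k * (p q^k)^n]; and the right-hand side, being at most a
constant times [`|p| ^+ n], tends to 0. *)
Lemma power_interchange {R : realType} {q z p C : R[i]} {c : nat -> R[i]} :
  0 < `|q| < 1 -> `|z| < 1 -> `|p| < 1 -> dominated C z c ->
  remainders
    (fun n => \big[+%R/0]_(0 <= k <oo) (c k * (p * q ^+ k) ^+ n : R[i]^o))
    (fun n => \big[+%R/0]_(0 <= k <oo)
                (c k / (1 - p * q ^+ k) * (p * q ^+ k) ^+ n : R[i]^o)).
Proof.
move=> hq z1 p1 cC; have hp := small_notin_poles hq p1.
have /andP[q0 q1] := hq; have [K qK] := factor_dominated p q1.
have := dominatedM cC qK; rewrite mulr1 => cK.
have dom n := dominated_power (p := p) n q1 cK.
split=> [n|].
  have [T aT _] := dominated_remainders z1 (dom n).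
  have [U aU _] := dominated_remainders z1 (dom n.+1).
  have cTU : remainders (fun k => c k * (p * q ^+ k) ^+ n) (fun k => T k - U k).
    apply: remainders_ext (remaindersB aT aU) => k; rewrite [_ ^+ n.+1]exprS.
    by field; exact: factor_neq0.
  rewrite (remainders_sum 0 aT) (remainders_sum 0 aU) (remainders_sum 0 cTU).
  by rewrite subrK.
apply: (dominated_cvg0 (C := C * K / (1 - `|z|)) p1) => n.
have [T aT /(_ 0%N)] := dominated_remainders z1 (dom n).
by rewrite (remainders_sum 0 aT) expr0 mulr1 mulrAC.
Qed.

(** * The double Lambert series *)

(** The tails [T] of the inner series are dominated by the powers of [y], so the
outer series converges as soon as [x y] lies in the unit disc. *)
Lemma double_lambertP {R : realType} {q x y : R[i]} (z w : R[i]) :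
  `|q| < 1 -> `|x * y| < 1 -> `|y| < 1 ->
  exists T B, [/\ remainders (fun m => y ^+ m / (1 - z * q ^+ m)) T,
    remainders (fun n => x ^+ n / (1 - w * q ^+ n) * T n) B
    & double_lambert q x y z w = B 0%N].
Proof.
move=> q1 xy1 y1.
have [K zK] := factor_dominated z q1; have [L wL] := factor_dominated w q1.
have := dominatedM (dominated_expr y) zK; rewrite mulr1.
move=> /(dominated_remainders y1)[T aT TK].
have := dominatedM (dominatedM (dominated_expr x) wL) TK; rewrite mulr1.
move=> /(dominated_remainders xy1)[B bB _].
exists T, B; split=> //; rewrite -(remainders_sum 0 bB) /double_lambert.
apply: eq_series => n; rewrite -(remainders_sum n (remaindersZ _ aT)).
by apply: eq_series => m; rewrite invfM mulrACA.
Qed.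

Lemma lambertP {R : realType} {q x : R[i]} {ys : seq R[i]} {a U : nat -> R[i]} :
  (forall n, x ^+ n / \prod_(y <- ys) (1 - y * q ^+ n) = a n) ->
  remainders a U -> lambert q x ys = U 0%N.
Proof. by move=> /funext<-; exact: remainders_sum. Qed.

(** Two applications of [power_interchange]. With the coefficients [z^k] and
ratio [y], it expands [T n] as the sum of [z^k (y q^k)^n / (1 - y q^k)]; with the
coefficients [z^k / (1 - y q^k)] and ratio [x y], it then sums [x^n T n]. *)
Lemma geometric_resummation {R : realType} {q x y z : R[i]} {T : nat -> R[i]} :
  0 < `|q| < 1 -> `|x * y| < 1 -> `|y| < 1 -> `|z| < 1 ->
  remainders (fun m => y ^+ m / (1 - z * q ^+ m)) T ->
  exists2 V, remainders (fun n => x ^+ n * T n) V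
    & V 0%N = lambert q z [:: y; x * y].
Proof.
move=> hq xy1 y1 z1 aT; have /andP[q0 q1] := hq.
have [K yK] := factor_dominated y q1.
have := dominatedM (dominated_expr z) yK; rewrite mulr1 => cK.
pose F n : R[i] := \big[+%R/0]_(0 <= k <oo)
  (z ^+ k / (1 - y * q ^+ k) * (y * q ^+ k) ^+ n : R[i]^o).
have TF : T =1 F.
  apply: (remainders_unique aT).
  apply: remainders_ext (power_interchange hq z1 y1 (dominated_expr z)) => n.
  have zqn1 : `|z * q ^+ n| < 1.
    rewrite normrM normrX (le_lt_trans _ z1) // ler_piMr // exprn_ile1 //.
    exact: ltW.
  have geo := remaindersZ (y ^+ n) (geometric_remainders zqn1).
  have := remainders_sum 0 geo; rewrite expr0 mulr1 => <-.
  by apply: eq_series => k; rewrite !exprMn -!exprM (mulnC k n); ring.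
exists (fun n => \big[+%R/0]_(0 <= k <oo) (z ^+ k / (1 - y * q ^+ k)
    / (1 - x * y * q ^+ k) * (x * y * q ^+ k) ^+ n : R[i]^o)).
  apply: remainders_ext (power_interchange hq z1 xy1 cK) => n.
  rewrite TF -(series_scale _ z1 (dominated_power n q1 cK)).
  by apply: eq_series => k; rewrite -(mulrA x) exprMn; ring.
apply: eq_series => k; rewrite expr0 mulr1 !big_cons big_nil mulr1.
by rewrite invfM mulrA.
Qed.

Theorem proposition2p2 (R : realType) (q : R[i]) (hq : 0 < `|q| < 1)
    (x y z w : R[i]) (hxy : `|x * y| < 1) (hy : `|y| < 1)
    (hz : forall r : nat, z <> q ^- r) (hw : forall r : nat, w <> q ^- r) :
  [/\ `|z| < 1 ->
        double_lambert q x y z w =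
          w * double_lambert q (x * q) y z w + lambert q z [:: y; x * y],
      double_lambert q x y z w =
        z * double_lambert q x (y * q) z w
          + 1 / (1 - y) * lambert q (x * y) [:: w],
      double_lambert q x y z w =
        y * double_lambert q x y (z * q) w + lambert q (x * y) [:: z; w]
    & double_lambert q x y z w =
        x * double_lambert q x y z (w * q)
          + 1 / (1 - w) * lambert q y [:: z]
          - x * lambert q (x * y) [:: z; w * q]].
Proof.
have /andP[q0 q1] := hq.
have z_neq0 := factor_neq0 q0 hz; have w_neq0 := factor_neq0 q0 hw.
have [T [B [aT bB ->]]] := double_lambertP z w q1 hxy hy.
have small p : `|p| < 1 -> `|p * q| < 1.
  by move=> p1; rewrite normrM mulr_ilt1.
split=> [z1|||].
- have xqy1 : `|x * q * y| < 1 by rewrite mulrAC small.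
  have [T' [B' [aT' bB' ->]]] := double_lambertP z w q1 xqy1 hy.
  have TT' := remainders_unique aT aT'.
  have [V aV VE] := geometric_resummation hq hxy hy z1 aT; rewrite -VE.
  have aV' : remainders (fun n => x ^+ n * T n) (fun n => B n - w * B' n).
    apply: remainders_ext (remaindersB bB (remaindersZ w bB')) => n.
    by rewrite -TT' exprMn; field.
  by rewrite (remainders_unique aV aV') addrC subrK.
- have xyq1 : `|x * (y * q)| < 1 by rewrite mulrA small.
  have [T' [B' [aT' bB' ->]]] := double_lambertP z w q1 xyq1 (small _ hy).
  have y_neq1 : 1 - y != 0.
    by rewrite subr_eq0; apply: contraTneq hy => <-; rewrite normr1 ltxx.
  have TT' n : T n = z * T' n + (1 - y)^-1 * y ^+ n.
    have geo : remainders (fun n => y ^+ n) (fun n => T n - z * T' n).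
      apply: remainders_ext (remaindersB aT (remaindersZ z aT')) => m.
      by rewrite exprMn; field.
    by rewrite -(remainders_unique geo (geometric_remainders hy)) addrC subrK.
  have -> : lambert q (x * y) [:: w] = (1 - y) * (B 0%N - z * B' 0%N).
    have bBB' := remaindersB bB (remaindersZ z bB').
    apply: lambertP (remaindersZ (1 - y) bBB') => n.
    by rewrite big_seq1 TT' exprMn; field; rewrite y_neq1 w_neq0.
  by field.
- have [T' [B' [aT' bB' ->]]] := double_lambertP (z * q) w q1 hxy hy.
  have TT' n : T n = y * T' n + y ^+ n / (1 - z * q ^+ n).
    have aS : remainders (fun n => y * (y ^+ n / (1 - z * q * q ^+ n)))
        (fun n => T n.+1).
      by apply: remainders_ext (remainders_shift aT) => m; rewrite !exprS !mulrA.
    by rewrite aT.1 addrC (remainders_unique aS (remaindersZ y aT')).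
  have -> : lambert q (x * y) [:: z; w] = B 0%N - y * B' 0%N.
    apply: lambertP (remaindersB bB (remaindersZ y bB')) => n.
    rewrite !big_cons big_nil mulr1 TT' exprMn.
    by field; rewrite z_neq0 w_neq0.
  by rewrite addrC subrK.
- have wq_neq0 n : 1 - w * q * q ^+ n != 0 by rewrite -mulrA -exprS.
  have [T' [B' [aT' bB' ->]]] := double_lambertP z (w * q) q1 hxy hy.
  have TT' := remainders_unique aT aT'.
  have [K zK] := factor_dominated z q1.
  have [L wL] := factor_dominated (w * q) q1.
  have := dominatedM (dominatedM (dominated_expr (x * y)) zK) wL.
  rewrite !mulr1; move=> /(dominated_remainders hxy)[U aU _].
  have -> : lambert q y [:: z] = T 0%N.
    by apply: lambertP aT => n; rewrite big_seq1.
  have -> : lambert q (x * y) [:: z; w * q] = U 0%N.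
    by apply: lambertP aU => n; rewrite !big_cons big_nil mulr1 invfM mulrA.
  have B1 : B 1%N = x * B' 0%N - x * U 0%N.
    have bS : remainders (fun n => x ^+ n.+1 / (1 - w * q ^+ n.+1) * T n.+1)
        (fun n => x * B' n - x * U n).
      have := remaindersB (remaindersZ x bB') (remaindersZ x aU).
      apply: remainders_ext => n.
      have -> : T n.+1 = T' n - y ^+ n / (1 - z * q ^+ n).
        by rewrite -TT' [T n]aT.1 addrAC subrr add0r.
      rewrite !exprS exprMn mulrA.
      by field; rewrite z_neq0 mulrA wq_neq0.
    by rewrite (remainders_unique (remainders_shift bB) bS).
  by rewrite bB.1 B1 !expr0 mulr1; ring.
Qed.
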